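(* Let $\mathcal R$ be a polarized rewrite system such that $\longrightarrow_{-}$ and $\longrightarrow_{+}$ commute and that has a pre-model, and fix such a pre-model of $\mathcal R$. Let $A$ be a proposition, $\pi$ a proof-term of $\Gamma \vdash_{\mathcal R} A$, and $\sigma$ a substitution defined on some of the proof variables declared in $\Gamma$ such that $\sigma(\alpha) \in |B|$ whenever $\alpha : B \in \Gamma$ and $\sigma$ is defined on $\alpha$. Then $\sigma\pi \in |A|$.
   Context: Propositions are built from atomic propositions (propositional symbols) and the constant $\bot$ using the binary connectives $\Rightarrow$, $\wedge$, $\vee$. A rewrite rule is a pair $P \longrightarrow A$ with $P$ an atomic proposition and $A$ an arbitrary proposition. A polarized rewrite system $\mathcal R = \langle \mathcal R_{-}, \mathcal R_{+}\rangle$ is a pair of sets of rewrite rules; rules of $\mathcal R_{-}$ are called negative, those of $\mathcal R_{+}$ positive. The one-step relations $\longrightarrow^1_{-}$, $\longrightarrow^1_{+}$ are the least relations on propositions such that: $P \longrightarrow^1_{-} A$ for every negative rule $P \longrightarrow A$; $P \longrightarrow^1_{+} A$ for every positive rule $P\longrightarrow A$; $A \Rightarrow B \longrightarrow^1_{-} A' \Rightarrow B$ if $A \longrightarrow^1_{+} A'$, and $A \Rightarrow B \longrightarrow^1_{-} A \Rightarrow B'$ if $B \longrightarrow^1_{-} B'$; $A \Rightarrow B \longrightarrow^1_{+} A' \Rightarrow B$ if $A \longrightarrow^1_{-} A'$, and $A \Rightarrow B \longrightarrow^1_{+} A \Rightarrow B'$ if $B \longrightarrow^1_{+} B'$; for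 $\circ \in \{\wedge, \vee\}$ and $s \in \{-,+\}$, $A \circ B \longrightarrow^1_{s} A' \circ B$ if $A \longrightarrow^1_{s} A'$, and $A \circ B \longrightarrow^1_{s} A \circ B'$ if $B \longrightarrow^1_{s} B'$. The relations $\longrightarrow_{-}$, $\longrightarrow_{+}$ are the reflexive-transitive closures of $\longrightarrow^1_{-}$, $\longrightarrow^1_{+}$; $B \longleftarrow_{s} A$ means $A \longrightarrow_{s} B$. They commute if whenever $A \longleftarrow_{-} B \longrightarrow_{+} C$ there is $D$ with $A \longrightarrow_{+} D \longleftarrow_{-} C$. Proof-terms: $\pi ::= \alpha \mid \lambda\alpha\,\pi \mid (\pi_1\,\pi_2) \mid \langle \pi_1,\pi_2\rangle \mid \mathit{fst}(\pi) \mid \mathit{snd}(\pi) \mid i(\pi) \mid j(\pi) \mid \delta(\pi_1, \alpha\pi_2, \beta\pi_3) \mid \delta_\bot(\pi)$, with $\alpha,\beta$ proof variables ($\lambda\alpha$ binds $\alpha$; in $\delta(\pi_1,\alpha\pi_2,\beta\pi_3)$, $\alpha$ is bound in $\pi_2$ and $\beta$ in $\pi_3$); $\sigma\pi$ denotes capture-avoiding simultaneous substitution. A context $\Gamma$ is a finite set of declarations $\alpha:B$ of distinct proof variables. ''$\pi$ is a proof-term of $\Gamma \vdash_{\mathcal R} A$'' is defined inductively: (axiom) $\alpha$ is one of $\Gamma \vdash_{\mathcal R} A$ if $\alpha:B \in \Gamma$ and $B \longrightarrow_{-} C \longleftarrow_{+} A$ for some $C$; ($\Rightarrow$-intro) if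 $\pi$ is one of $\Gamma, \alpha:A \vdash_{\mathcal R} B$ and $C \longrightarrow_{+} (A \Rightarrow B)$ then $\lambda\alpha\,\pi$ is one of $\Gamma \vdash_{\mathcal R} C$; ($\Rightarrow$-elim) if $\pi_1$ is one of $\Gamma\vdash_{\mathcal R} C$ with $C \longrightarrow_{-} (A \Rightarrow B)$ and $\pi_2$ one of $\Gamma \vdash_{\mathcal R} A$, then $(\pi_1\,\pi_2)$ is one of $\Gamma \vdash_{\mathcal R} B$; ($\wedge$-intro) if $\pi_1$ is one of $\Gamma \vdash_{\mathcal R} A$, $\pi_2$ one of $\Gamma\vdash_{\mathcal R} B$ and $C \longrightarrow_{+} (A\wedge B)$, then $\langle\pi_1,\pi_2\rangle$ is one of $\Gamma \vdash_{\mathcal R} C$; ($\wedge$-elim) if $\pi$ is one of $\Gamma \vdash_{\mathcal R} C$ and $C \longrightarrow_{-} (A \wedge B)$ then $\mathit{fst}(\pi)$ is one of $\Gamma\vdash_{\mathcal R} A$ and $\mathit{snd}(\pi)$ one of $\Gamma \vdash_{\mathcal R} B$; ($\vee$-intro) if $\pi$ is one of $\Gamma\vdash_{\mathcal R} A$ (resp. $\Gamma \vdash_{\mathcal R} B$) and $C \longrightarrow_{+} (A \vee B)$ then $i(\pi)$ (resp. $j(\pi)$) is one of $\Gamma \vdash_{\mathcal R} C$; ($\vee$-elim) if $\pi_1$ is one of $\Gamma\vdash_{\mathcal R} D$ with $D \longrightarrow_{-} (A\vee B)$, $\pi_2$ one of $\Gamma,\alpha:A \vdash_{\mathcal R} C$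 and $\pi_3$ one of $\Gamma,\beta:B\vdash_{\mathcal R} C$, then $\delta(\pi_1,\alpha\pi_2,\beta\pi_3)$ is one of $\Gamma \vdash_{\mathcal R} C$; ($\bot$-elim) if $\pi$ is one of $\Gamma \vdash_{\mathcal R} B$ with $B \longrightarrow_{-} \bot$ then $\delta_\bot(\pi)$ is one of $\Gamma \vdash_{\mathcal R} A$ for every $A$. Proof reduction: $\triangleright^1$ is the closure under all term contexts of $(\lambda\alpha\,\pi_1\;\pi_2) \triangleright [\pi_2/\alpha]\pi_1$, $\mathit{fst}(\langle\pi_1,\pi_2\rangle) \triangleright \pi_1$, $\mathit{snd}(\langle\pi_1,\pi_2\rangle)\triangleright \pi_2$, $\delta(i(\pi_1),\alpha\pi_2,\beta\pi_3)\triangleright[\pi_1/\alpha]\pi_2$, $\delta(j(\pi_1),\alpha\pi_2,\beta\pi_3)\triangleright[\pi_1/\beta]\pi_3$; $\triangleright$ is its reflexive-transitive closure (''$\pi$ reduces to $\pi'$''). A proof-term is strongly normalizable if there is no infinite $\triangleright^1$-sequence from it. A proof-term is neutral if it is a variable or of the form $(\pi_1\,\pi_2)$, $\mathit{fst}(\pi)$, $\mathit{snd}(\pi)$, $\delta(\pi_1,\alpha\pi_2,\beta\pi_3)$ or $\delta_\bot(\pi)$. A set $R$ of proof-terms is a reducibility candidate if: every element is strongly normalizable; $\pi\in R$ and $\pi\triangleright\pi'$ imply $\pi'\in R$; if $\pi$ is neutral and every $\pi'$ with $\pi\triangleright^1\pi'$ is in $R$ then $\pi\in R$. A pre-model assigns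 a reducibility candidate $\hat P$ to each atomic $P$. Then $|P| = \hat P$; $\pi \in |A \Rightarrow B|$ iff $\pi$ is strongly normalizable and whenever $\pi$ reduces to $\lambda\alpha\,\pi_1$, $[\pi'/\alpha]\pi_1 \in |B|$ for all $\pi' \in |A|$; $\pi \in |A \wedge B|$ iff $\pi$ is strongly normalizable and whenever $\pi$ reduces to $\langle\pi_1,\pi_2\rangle$, $\pi_1\in|A|$ and $\pi_2\in|B|$; $\pi \in |A\vee B|$ iff $\pi$ is strongly normalizable and whenever $\pi$ reduces to $i(\pi_1)$ (resp. $j(\pi_2)$), $\pi_1\in|A|$ (resp. $\pi_2\in|B|$); $|\bot|$ is the set of strongly normalizable proof-terms. A pre-model of $\mathcal R$ is a pre-model with $|P|\subseteq|A|$ for each negative rule $P\longrightarrow A$ and $|A|\subseteq|P|$ for each positive rule $P\longrightarrow A$. *)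

(* Defs.v *)
From Stdlib Require Import List Relation_Operators.

Set Implicit Arguments.

Inductive proposition (Atom : Type) : Type :=
| Atomic (P : Atom)
| Bot
| Imp (A B : proposition Atom)
| And (A B : proposition Atom)
| Or (A B : proposition Atom).

Arguments Bot {Atom}.

Inductive polarity : Set := Neg | Pos.

Definition opp (s : polarity) : polarity :=
  match s with Neg => Pos | Pos => Neg end.

Definition rule_set (Atom : Type) : Type := Atom -> proposition Atom -> Prop.

Record rewrite_system (Atom : Type) : Type := RewriteSystem {
  neg_rules : rule_set Atom;
  pos_rules : rule_set Atom
}.

Definition rules (Atom : Type) (R : rewrite_system Atom) (s : polarity)
  : rule_set Atom :=
  match s with Neg => neg_rules R | Pos => pos_rules R end.

Inductive rew1 (Atom : Type) (R : rewrite_system Atom)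
  : polarity -> proposition Atom -> proposition Atom -> Prop :=
| rew1_rule s P A : rules R s P A -> rew1 R s (Atomic P) A
| rew1_imp_l s A A' B :
    rew1 R (opp s) A A' -> rew1 R s (Imp A B) (Imp A' B)
| rew1_imp_r s A B B' :
    rew1 R s B B' -> rew1 R s (Imp A B) (Imp A B')
| rew1_and_l s A A' B :
    rew1 R s A A' -> rew1 R s (And A B) (And A' B)
| rew1_and_r s A B B' :
    rew1 R s B B' -> rew1 R s (And A B) (And A B')
| rew1_or_l s A A' B :
    rew1 R s A A' -> rew1 R s (Or A B) (Or A' B)
| rew1_or_r s A B B' :
    rew1 R s B B' -> rew1 R s (Or A B) (Or A B').

Definition rew (Atom : Type) (R : rewrite_system Atom) (s : polarity)
  : proposition Atom -> proposition Atom -> Prop :=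
  clos_refl_trans _ (rew1 R s).

Definition commuting (Atom : Type) (R : rewrite_system Atom) : Prop :=
  forall A B C, rew R Neg B A -> rew R Pos B C ->
    exists D, rew R Pos A D /\ rew R Neg C D.

(** Proof-terms up to alpha-equivalence, with de Bruijn indices: [Lam] binds
    index 0 of its argument, and [Case t u v], that is delta(t, alpha u, beta v),
    binds index 0 of [u] and index 0 of [v]. *)
Inductive proof_term : Set :=
| Var (n : nat)
| Lam (t : proof_term)
| App (t u : proof_term)
| Pair (t u : proof_term)
| Fst (t : proof_term)
| Snd (t : proof_term)
| Inl (t : proof_term)
| Inr (t : proof_term)
| Case (t u v : proof_term)
| Absurd (t : proof_term).

Definition up_ren (r : nat -> nat) (n : nat) : nat :=
  match n with 0 => 0 | S n => S (r n) end.

Fixpoint rename (r : nat -> nat) (t : proof_term) : proof_term :=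
  match t with
  | Var n => Var (r n)
  | Lam t => Lam (rename (up_ren r) t)
  | App t u => App (rename r t) (rename r u)
  | Pair t u => Pair (rename r t) (rename r u)
  | Fst t => Fst (rename r t)
  | Snd t => Snd (rename r t)
  | Inl t => Inl (rename r t)
  | Inr t => Inr (rename r t)
  | Case t u v =>
      Case (rename r t) (rename (up_ren r) u) (rename (up_ren r) v)
  | Absurd t => Absurd (rename r t)
  end.

Definition up (s : nat -> proof_term) (n : nat) : proof_term :=
  match n with 0 => Var 0 | S n => rename S (s n) end.

Fixpoint subst (s : nat -> proof_term) (t : proof_term) : proof_term :=
  match t with
  | Var n => s n
  | Lam t => Lam (subst (up s) t)
  | App t u => App (subst s t) (subst s u)
  | Pair t u => Pair (subst s t) (subst s u)
  | Fst t => Fst (subst s t)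
  | Snd t => Snd (subst s t)
  | Inl t => Inl (subst s t)
  | Inr t => Inr (subst s t)
  | Case t u v => Case (subst s t) (subst (up s) u) (subst (up s) v)
  | Absurd t => Absurd (subst s t)
  end.

(** [subst1 u t] is [u/alpha]t, where alpha is index 0 of [t]; the other
    indices are shifted down because the binder of alpha disappears. *)
Definition subst1 (u t : proof_term) : proof_term :=
  subst (fun n => match n with 0 => u | S n => Var n end) t.

Definition partial_subst : Type := nat -> option proof_term.

(** Variables on which the substitution is undefined are left unchanged. *)
Definition apply_subst (sigma : partial_subst) (t : proof_term) : proof_term :=
  subst (fun n => match sigma n with Some u => u | None => Var n end) t.

(** The context [B0 :: B1 :: ...] declares index 0 with [B0], index 1 with
    [B1], and so on; distinctness of the declared variables is built in. *)
Definition context (Atom : Type) : Type := list (proposition Atom).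

Definition declares (Atom : Type) (Gamma : context Atom) (n : nat)
  (B : proposition Atom) : Prop :=
  nth_error Gamma n = Some B.

Inductive proof_of (Atom : Type) (R : rewrite_system Atom)
  : context Atom -> proof_term -> proposition Atom -> Prop :=
| proof_axiom Gamma n A B C :
    declares Gamma n B -> rew R Neg B C -> rew R Pos A C ->
    proof_of R Gamma (Var n) A
| proof_imp_intro Gamma t A B C :
    proof_of R (A :: Gamma) t B -> rew R Pos C (Imp A B) ->
    proof_of R Gamma (Lam t) C
| proof_imp_elim Gamma t u A B C :
    proof_of R Gamma t C -> rew R Neg C (Imp A B) ->
    proof_of R Gamma u A ->
    proof_of R Gamma (App t u) B
| proof_and_intro Gamma t u A B C :
    proof_of R Gamma t A -> proof_of R Gamma u B ->
    rew R Pos C (And A B) ->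
    proof_of R Gamma (Pair t u) C
| proof_and_elim_l Gamma t A B C :
    proof_of R Gamma t C -> rew R Neg C (And A B) ->
    proof_of R Gamma (Fst t) A
| proof_and_elim_r Gamma t A B C :
    proof_of R Gamma t C -> rew R Neg C (And A B) ->
    proof_of R Gamma (Snd t) B
| proof_or_intro_l Gamma t A B C :
    proof_of R Gamma t A -> rew R Pos C (Or A B) ->
    proof_of R Gamma (Inl t) C
| proof_or_intro_r Gamma t A B C :
    proof_of R Gamma t B -> rew R Pos C (Or A B) ->
    proof_of R Gamma (Inr t) C
| proof_or_elim Gamma t u v A B C D :
    proof_of R Gamma t D -> rew R Neg D (Or A B) ->
    proof_of R (A :: Gamma) u C -> proof_of R (B :: Gamma) v C ->
    proof_of R Gamma (Case t u v) C
| proof_bot_elim Gamma t A B :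
    proof_of R Gamma t B -> rew R Neg B Bot ->
    proof_of R Gamma (Absurd t) A.

Inductive red1 : proof_term -> proof_term -> Prop :=
| red1_beta t u : red1 (App (Lam t) u) (subst1 u t)
| red1_fst t u : red1 (Fst (Pair t u)) t
| red1_snd t u : red1 (Snd (Pair t u)) u
| red1_case_inl t u v : red1 (Case (Inl t) u v) (subst1 t u)
| red1_case_inr t u v : red1 (Case (Inr t) u v) (subst1 t v)
| red1_Lam t t' : red1 t t' -> red1 (Lam t) (Lam t')
| red1_App_l t t' u : red1 t t' -> red1 (App t u) (App t' u)
| red1_App_r t u u' : red1 u u' -> red1 (App t u) (App t u')
| red1_Pair_l t t' u : red1 t t' -> red1 (Pair t u) (Pair t' u)
| red1_Pair_r t u u' : red1 u u' -> red1 (Pair t u) (Pair t u')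
| red1_Fst t t' : red1 t t' -> red1 (Fst t) (Fst t')
| red1_Snd t t' : red1 t t' -> red1 (Snd t) (Snd t')
| red1_Inl t t' : red1 t t' -> red1 (Inl t) (Inl t')
| red1_Inr t t' : red1 t t' -> red1 (Inr t) (Inr t')
| red1_Case_1 t t' u v : red1 t t' -> red1 (Case t u v) (Case t' u v)
| red1_Case_2 t u u' v : red1 u u' -> red1 (Case t u v) (Case t u' v)
| red1_Case_3 t u v v' : red1 v v' -> red1 (Case t u v) (Case t u v')
| red1_Absurd t t' : red1 t t' -> red1 (Absurd t) (Absurd t').

Definition red : proof_term -> proof_term -> Prop :=
  clos_refl_trans _ red1.

Definition strongly_normalizable (t : proof_term) : Prop :=
  ~ exists f : nat -> proof_term,
      f 0 = t /\ forall n, red1 (f n) (f (S n)).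

Definition neutral (t : proof_term) : Prop :=
  match t with
  | Var _ | App _ _ | Fst _ | Snd _ | Case _ _ _ | Absurd _ => True
  | Lam _ | Pair _ _ | Inl _ | Inr _ => False
  end.

Record reducibility_candidate (E : proof_term -> Prop) : Prop := {
  candidate_sn : forall t, E t -> strongly_normalizable t;
  candidate_red : forall t t', E t -> red t t' -> E t';
  candidate_neutral : forall t,
    neutral t -> (forall t', red1 t t' -> E t') -> E t
}.

Record pre_model (Atom : Type) : Type := PreModel {
  atom_interp : Atom -> proof_term -> Prop;
  atom_interp_candidate : forall P, reducibility_candidate (atom_interp P)
}.

Fixpoint interp (Atom : Type) (M : pre_model Atom) (A : proposition Atom)
  (t : proof_term) {struct A} : Prop :=
  match A with
  | Atomic P => atom_interp M P t
  | Bot => strongly_normalizable t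
  | Imp A B =>
      strongly_normalizable t /\
      forall t1, red t (Lam t1) ->
        forall u, interp M A u -> interp M B (subst1 u t1)
  | And A B =>
      strongly_normalizable t /\
      forall t1 t2, red t (Pair t1 t2) -> interp M A t1 /\ interp M B t2
  | Or A B =>
      strongly_normalizable t /\
      (forall t1, red t (Inl t1) -> interp M A t1) /\
      (forall t2, red t (Inr t2) -> interp M B t2)
  end.

Definition pre_model_of (Atom : Type) (R : rewrite_system Atom)
  (M : pre_model Atom) : Prop :=
  (forall P A, neg_rules R P A ->
    forall t, interp M (Atomic P) t -> interp M A t) /\
  (forall P A, pos_rules R P A ->
    forall t, interp M A t -> interp M (Atomic P) t).

(* Main.v *)
(** Every [|A|] is a reducibility candidate, a negative rewrite step enlarges
    the interpretation and a positive one shrinks it, and each typing rule then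
    becomes a closure property of candidates. Candidates need not be closed under
    renaming, so a bound variable is never interpreted by lifting the
    substitution under the binder: the body is instantiated by an arbitrary
    element of the candidate, and its strong normalizability is read off the
    instance at a variable, because reduction is stable under substitution. *)

From Stdlib Require Import List Relation_Operators Classical ClassicalEpsilon.
Require Import Defs.

Set Implicit Arguments.

(** * Substitution calculus *)

(** Instantiates a bound variable directly: unlike [up], it does not shift [s], so no closure of
    candidates under renaming is needed. *)
Definition scons (u : proof_term) (s : nat -> proof_term) (n : nat)
  : proof_term :=
  match n with 0 => u | S n => s n end.

Lemma up_ext (s s' : nat -> proof_term) :
  (forall n, s n = s' n) -> forall n, up s n = up s' n.
Proof. intros H [|n]; simpl; now rewrite ?H. Qed.

Lemma subst_ext (t : proof_term) : forall s s',
  (forall n, s n = s' n) -> subst s t = subst s' t.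
Proof.
  induction t; intros s s' H; simpl; [apply H|..]; f_equal; auto using up_ext.
Qed.

Lemma subst_Var (t : proof_term) : forall s,
  (forall n, s n = Var n) -> subst s t = t.
Proof.
  assert (Hup : forall s, (forall n, s n = Var n) ->
    forall n, up s n = Var n).
  { intros s H [|n]; simpl; now rewrite ?H. }
  induction t; intros s H; simpl; [apply H|..]; f_equal; auto.
Qed.

(** Makes the composition of two renamings an instance of [subst_rename]. *)
Lemma rename_as_subst (t : proof_term) : forall r s,
  (forall n, s n = Var (r n)) -> rename r t = subst s t.
Proof.
  assert (Hup : forall r s, (forall n, s n = Var (r n)) ->
    forall n, up s n = Var (up_ren r n)).
  { intros r s H [|n]; simpl; now rewrite ?H. }
  induction t; intros r s H; simpl; [now rewrite H|..]; f_equal; auto.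
Qed.

(** The composite is a separate argument fixed by a pointwise equation: this form passes under
    binders and avoids functional extensionality. *)
Lemma subst_rename (t : proof_term) : forall r s s',
  (forall n, s (r n) = s' n) -> subst s (rename r t) = subst s' t.
Proof.
  assert (Hup : forall r s s', (forall n, s (r n) = s' n) ->
    forall n, up s (up_ren r n) = up s' n).
  { intros r s s' H [|n]; simpl; now rewrite ?H. }
  induction t; intros r s s' H; simpl; [apply H|..]; f_equal; eauto.
Qed.

Lemma rename_rename (t : proof_term) : forall r r' r'',
  (forall n, r (r' n) = r'' n) -> rename r (rename r' t) = rename r'' t.
Proof.
  intros r r' r'' H.
  rewrite (rename_as_subst (rename r' t) r (fun n => Var (r n))) by auto.
  rewrite (rename_as_subst t r'' (fun n => Var (r'' n))) by auto.
  apply subst_rename; intros n; now rewrite H.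
Qed.

Lemma rename_subst (t : proof_term) : forall r s s',
  (forall n, rename r (s n) = s' n) -> rename r (subst s t) = subst s' t.
Proof.
  assert (Hup : forall r s s', (forall n, rename r (s n) = s' n) ->
    forall n, rename (up_ren r) (up s n) = up s' n).
  { intros r s s' H [|n]; simpl; [reflexivity|].
    rewrite <- H, (rename_rename (s n) (up_ren r) S (fun m => S (r m)))
      by auto.
    symmetry; now apply rename_rename. }
  induction t; intros r s s' H; simpl; [apply H|..]; f_equal; eauto.
Qed.

Lemma subst_subst (t : proof_term) : forall s s' s'',
  (forall n, subst s (s' n) = s'' n) -> subst s (subst s' t) = subst s'' t.
Proof.
  assert (Hup : forall s s' s'', (forall n, subst s (s' n) = s'' n) ->
    forall n, subst (up s) (up s' n) = up s'' n).
  { intros s s' s'' H [|n]; simpl; [reflexivity|].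
    rewrite <- H, (subst_rename (s' n) S (up s) (fun m => rename S (s m)))
      by auto.
    symmetry; now apply rename_subst. }
  induction t; intros s s' s'' H; simpl; [apply H|..]; f_equal; eauto.
Qed.

(** The shift made by [up] is cancelled by the instantiation. This turns an instance of a
    substituted body into a single substitution, as the induction on derivations requires. *)
Lemma subst1_up (s : nat -> proof_term) (u t : proof_term) :
  subst1 u (subst (up s) t) = subst (scons u s) t.
Proof.
  apply subst_subst; intros [|n]; simpl; [reflexivity|].
  rewrite (subst_rename (s n) S _ Var) by auto.
  now apply subst_Var.
Qed.

Lemma subst_subst1 (s : nat -> proof_term) (u t : proof_term) :
  subst s (subst1 u t) = subst1 (subst s u) (subst (up s) t).
Proof.
  rewrite subst1_up; apply subst_subst; now intros [|n].
Qed.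

(** * Reduction *)

Lemma red1_subst (t t' : proof_term) :
  red1 t t' -> forall s, red1 (subst s t) (subst s t').
Proof.
  intros H; induction H; intros s; simpl; rewrite ?subst_subst1;
    eauto using red1.
Qed.

Lemma red_subst (s : nat -> proof_term) (t t' : proof_term) :
  red t t' -> red (subst s t) (subst s t').
Proof.
  intros H; induction H.
  - apply rt_step; now apply red1_subst.
  - apply rt_refl.
  - eapply rt_trans; eassumption.
Qed.

(** Exposes the first step, which the transitivity constructor of [clos_refl_trans] hides. *)
Lemma red_inv (t t' : proof_term) :
  red t t' -> t = t' \/ exists t1, red1 t t1 /\ red t1 t'.
Proof.
  intros H; induction H as [t t' H|t|t t1 t' H1 IH1 H2 IH2].
  - right; exists t'; split; [assumption|apply rt_refl].
  - now left.
  - destruct IH1 as [->|(t2 & Ht & Ht2)]; [assumption|].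
    right; exists t2; split; [assumption|].
    eapply rt_trans; eassumption.
Qed.

(** An introduction is never a redex at its root, so every step takes place strictly below it;
    likewise for pairs and injections. *)
Lemma red_Lam_inv (t v : proof_term) :
  red (Lam t) v -> exists t', v = Lam t' /\ red t t'.
Proof.
  intros H; remember (Lam t) as w eqn:E; revert t E.
  induction H as [w v H|w|w w1 v H1 IH1 H2 IH2]; intros t ->.
  - inversion H; subst; eexists; split; [reflexivity|now apply rt_step].
  - eexists; split; [reflexivity|apply rt_refl].
  - destruct (IH1 _ eq_refl) as (t1 & -> & Ht1).
    destruct (IH2 _ eq_refl) as (t2 & -> & Ht2).
    eexists; split; [reflexivity|eapply rt_trans; eassumption].
Qed.

Lemma red_Pair_inv (t u v : proof_term) :
  red (Pair t u) v -> exists t' u', v = Pair t' u' /\ red t t' /\ red u u'.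
Proof.
  intros H; remember (Pair t u) as w eqn:E; revert t u E.
  induction H as [w v H|w|w w1 v H1 IH1 H2 IH2]; intros t u ->.
  - inversion H; subst; do 2 eexists;
      (split; [reflexivity|split; (now apply rt_step) || apply rt_refl]).
  - do 2 eexists; split; [reflexivity|split; apply rt_refl].
  - destruct (IH1 _ _ eq_refl) as (t1 & u1 & -> & Ht1 & Hu1).
    destruct (IH2 _ _ eq_refl) as (t2 & u2 & -> & Ht2 & Hu2).
    do 2 eexists; split; [reflexivity|split; eapply rt_trans; eassumption].
Qed.

Lemma red_Inl_inv (t v : proof_term) :
  red (Inl t) v -> exists t', v = Inl t' /\ red t t'.
Proof.
  intros H; remember (Inl t) as w eqn:E; revert t E.
  induction H as [w v H|w|w w1 v H1 IH1 H2 IH2]; intros t ->.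
  - inversion H; subst; eexists; split; [reflexivity|now apply rt_step].
  - eexists; split; [reflexivity|apply rt_refl].
  - destruct (IH1 _ eq_refl) as (t1 & -> & Ht1).
    destruct (IH2 _ eq_refl) as (t2 & -> & Ht2).
    eexists; split; [reflexivity|eapply rt_trans; eassumption].
Qed.

Lemma red_Inr_inv (t v : proof_term) :
  red (Inr t) v -> exists t', v = Inr t' /\ red t t'.
Proof.
  intros H; remember (Inr t) as w eqn:E; revert t E.
  induction H as [w v H|w|w w1 v H1 IH1 H2 IH2]; intros t ->.
  - inversion H; subst; eexists; split; [reflexivity|now apply rt_step].
  - eexists; split; [reflexivity|apply rt_refl].
  - destruct (IH1 _ eq_refl) as (t1 & -> & Ht1).
    destruct (IH2 _ eq_refl) as (t2 & -> & Ht2).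
    eexists; split; [reflexivity|eapply rt_trans; eassumption].
Qed.

(** * Strong normalization *)

Lemma sn_intro (t : proof_term) :
  (forall t', red1 t t' -> strongly_normalizable t') ->
  strongly_normalizable t.
Proof.
  intros H (f & <- & Hf).
  apply (H (f 1) (Hf 0)).
  exists (fun n => f (S n)); auto.
Qed.

Lemma sn_red1 (t t' : proof_term) :
  strongly_normalizable t -> red1 t t' -> strongly_normalizable t'.
Proof.
  intros Ht H (f & Hf0 & Hf); apply Ht.
  exists (fun n => match n with 0 => t | S n => f n end).
  split; [reflexivity|].
  intros [|n]; [now rewrite Hf0|apply Hf].
Qed.

Lemma sn_red (t t' : proof_term) :
  red t t' -> strongly_normalizable t -> strongly_normalizable t'.
Proof. intros H; induction H; eauto using sn_red1. Qed.

(** Passes from the absence of infinite sequences to well-founded induction; the argument is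
    classical and uses choice. *)
Lemma sn_acc (t : proof_term) :
  strongly_normalizable t -> Acc (fun t' t => red1 t t') t.
Proof.
  intros Ht; apply NNPP; intros Hacc; apply Ht.
  set (bad := {t | ~ Acc (fun t' t => red1 t t') t}).
  (* A term all of whose reducts are accessible is accessible, so a bad term has a bad reduct;
     choosing one each time and iterating gives an infinite reduction. *)
  assert (Hstep : forall b : bad,
    {b' : bad | red1 (proj1_sig b) (proj1_sig b')}).
  { intros [b Hb]; apply constructive_indefinite_description; simpl.
    apply NNPP; intros Hno; apply Hb; constructor; intros b' Hb'.
    apply NNPP; intros Hnb'; apply Hno.
    now exists (exist _ b' Hnb'). }
  exists (fun n => proj1_sig
    (nat_rect (fun _ => bad) (exist _ t Hacc)
       (fun _ b => proj1_sig (Hstep b)) n)).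
  split; [reflexivity|].
  intros n; simpl; apply (proj2_sig (Hstep _)).
Qed.

Lemma sn_ind (P : proof_term -> Prop) :
  (forall t, strongly_normalizable t -> (forall t', red1 t t' -> P t') -> P t) ->
  forall t, strongly_normalizable t -> P t.
Proof.
  intros HP t Ht.
  pose proof (sn_acc Ht) as Hacc.
  induction Hacc as [t _ IH]; eauto using sn_red1.
Qed.

(** Substitution maps an infinite reduction, step by step, to an infinite reduction. *)
Lemma sn_subst_inv (s : nat -> proof_term) (t : proof_term) :
  strongly_normalizable (subst s t) -> strongly_normalizable t.
Proof.
  intros H (f & <- & Hf); apply H.
  exists (fun n => subst s (f n)); auto using red1_subst.
Qed.

Lemma sn_Lam (t : proof_term) :
  strongly_normalizable t -> strongly_normalizable (Lam t).
Proof.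
  intros Ht; pattern t; revert t Ht; apply sn_ind; intros t _ IH.
  apply sn_intro; intros t' H; inversion H; subst; auto.
Qed.

Lemma sn_Inl (t : proof_term) :
  strongly_normalizable t -> strongly_normalizable (Inl t).
Proof.
  intros Ht; pattern t; revert t Ht; apply sn_ind; intros t _ IH.
  apply sn_intro; intros t' H; inversion H; subst; auto.
Qed.

Lemma sn_Inr (t : proof_term) :
  strongly_normalizable t -> strongly_normalizable (Inr t).
Proof.
  intros Ht; pattern t; revert t Ht; apply sn_ind; intros t _ IH.
  apply sn_intro; intros t' H; inversion H; subst; auto.
Qed.

Lemma sn_Pair (t u : proof_term) :
  strongly_normalizable t -> strongly_normalizable u ->
  strongly_normalizable (Pair t u).
Proof.
  (* [u] is generalized first, so that the outer hypothesis still applies after the inner induction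
     has replaced [u] by a reduct. *)
  intros Ht; revert u; pattern t; revert t Ht; apply sn_ind; intros t _ IHt u Hu.
  pattern u; revert u Hu; apply sn_ind; intros u Hu IHu.
  apply sn_intro; intros t' H; inversion H; subst; auto.
Qed.

(** * Candidates *)

(** A variable is neutral and has no reduct, so the third clause applies vacuously. *)
Lemma candidate_Var (E : proof_term -> Prop) (n : nat) :
  reducibility_candidate E -> E (Var n).
Proof.
  intros HE; apply (candidate_neutral HE); [exact I|].
  intros t' H; inversion H.
Qed.

(** A reduction from a neutral term to an introduction is nonempty; its first reduct is where the
    hypothesis of the third clause gets used. *)
Lemma neutral_red_inv (t v : proof_term) :
  neutral t -> red t v -> ~ neutral v -> exists t1, red1 t t1 /\ red t1 v.
Proof.
  intros Ht H Hv; destruct (red_inv H) as [->|H']; [contradiction|assumption].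
Qed.

Section Interpretation.

Variables (Atom : Type) (M : pre_model Atom).

Lemma interp_candidate (A : proposition Atom) :
  reducibility_candidate (interp M A).
Proof.
  induction A as [P| |A IHA B IHB|A IHA B IHB|A IHA B IHB].
  - apply atom_interp_candidate.
  - split; simpl; eauto using sn_red, sn_intro.
  - split; simpl.
    + tauto.
    + intros t t' [Ht H] Hr; split; [eauto using sn_red|].
      intros t1 H1; apply H; eapply rt_trans; eassumption.
    + intros t Hn H; split.
      * apply sn_intro; intros t' H'; now apply H.
      * intros t1 H1.
        destruct (neutral_red_inv Hn H1) as (t' & Ht & Ht'); [tauto|].
        now apply (H t' Ht).
  - split; simpl.
    + tauto.
    + intros t t' [Ht H] Hr; split; [eauto using sn_red|].
      intros t1 t2 H1; apply H; eapply rt_trans; eassumption.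
    + intros t Hn H; split.
      * apply sn_intro; intros t' H'; now apply H.
      * intros t1 t2 H1.
        destruct (neutral_red_inv Hn H1) as (t' & Ht & Ht'); [tauto|].
        now apply (H t' Ht).
  - split; simpl.
    + tauto.
    + intros t t' (Ht & Hl & Hr) H; split; [eauto using sn_red|split].
      * intros t1 H1; apply Hl; eapply rt_trans; eassumption.
      * intros t1 H1; apply Hr; eapply rt_trans; eassumption.
    + intros t Hn H; split; [|split].
      * apply sn_intro; intros t' H'; now apply H.
      * intros t1 H1.
        destruct (neutral_red_inv Hn H1) as (t' & Ht & Ht'); [tauto|].
        now apply (H t' Ht).
      * intros t1 H1.
        destruct (neutral_red_inv Hn H1) as (t' & Ht & Ht'); [tauto|].
        now apply (H t' Ht).
Qed.

Lemma interp_sn (A : proposition Atom) (t : proof_term) :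
  interp M A t -> strongly_normalizable t.
Proof. apply (candidate_sn (interp_candidate A)). Qed.

Lemma interp_red1 (A : proposition Atom) (t t' : proof_term) :
  interp M A t -> red1 t t' -> interp M A t'.
Proof.
  intros Ht H; apply (candidate_red (interp_candidate A)) with t; [assumption|].
  now apply rt_step.
Qed.

(** [Var 0] serves as a witness because a variable lies in every candidate. *)
Lemma sn_of_instances (A B : proposition Atom) (t : proof_term) :
  (forall u, interp M A u -> interp M B (subst1 u t)) ->
  strongly_normalizable t.
Proof.
  intros H; eapply sn_subst_inv, interp_sn.
  apply (H (Var 0)), candidate_Var, interp_candidate.
Qed.

(** * Closure of the interpretation under introductions and eliminations *)

Lemma interp_Lam (A B : proposition Atom) (t : proof_term) :
  (forall u, interp M A u -> interp M B (subst1 u t)) ->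
  interp M (Imp A B) (Lam t).
Proof.
  intros H; split; [eapply sn_Lam, sn_of_instances; eassumption|].
  intros t1 H1 u Hu; destruct (red_Lam_inv H1) as (t' & E & Ht').
  injection E as <-.
  (* The instance of the reduced body is a reduct of the instance of the original body. *)
  apply (candidate_red (interp_candidate B)) with (subst1 u t); [auto|].
  now apply red_subst.
Qed.

(** An application is neutral, so only its one-step reducts matter; nested induction on the strong
    normalizability of [t] and [u] handles the inner steps. *)
Lemma interp_App (A B : proposition Atom) (t u : proof_term) :
  interp M (Imp A B) t -> interp M A u -> interp M B (App t u).
Proof.
  intros Ht; pose proof (interp_sn _ Ht) as Hsn; revert Ht u.
  pattern t; revert t Hsn; apply sn_ind; intros t _ IHt Ht u Hu.
  pose proof (interp_sn _ Hu) as Hsn; revert Hu.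
  pattern u; revert u Hsn; apply sn_ind; intros u _ IHu Hu.
  apply (candidate_neutral (interp_candidate B)); [exact I|].
  intros t' H; inversion H; subst.
  (* At the root redex [t] is itself an abstraction, so its membership is used with the empty
     reduction. *)
  - apply Ht; [apply rt_refl|assumption].
  - eauto using interp_red1.
  - eauto using interp_red1.
Qed.

Lemma interp_Pair (A B : proposition Atom) (t u : proof_term) :
  interp M A t -> interp M B u -> interp M (And A B) (Pair t u).
Proof.
  intros Ht Hu; split; [eauto using sn_Pair, interp_sn|].
  intros t1 u1 H; destruct (red_Pair_inv H) as (t' & u' & E & Ht' & Hu').
  injection E as <- <-.
  split; [apply (candidate_red (interp_candidate A)) with t
         |apply (candidate_red (interp_candidate B)) with u]; assumption.
Qed.

Lemma interp_Fst (A B : proposition Atom) (t : proof_term) :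
  interp M (And A B) t -> interp M A (Fst t).
Proof.
  intros Ht; pose proof (interp_sn _ Ht) as Hsn; revert Ht.
  pattern t; revert t Hsn; apply sn_ind; intros t _ IHt Ht.
  apply (candidate_neutral (interp_candidate A)); [exact I|].
  intros t' H; inversion H; subst.
  - eapply Ht, rt_refl.
  - eauto using interp_red1.
Qed.

Lemma interp_Snd (A B : proposition Atom) (t : proof_term) :
  interp M (And A B) t -> interp M B (Snd t).
Proof.
  intros Ht; pose proof (interp_sn _ Ht) as Hsn; revert Ht.
  pattern t; revert t Hsn; apply sn_ind; intros t _ IHt Ht.
  apply (candidate_neutral (interp_candidate B)); [exact I|].
  intros t' H; inversion H; subst.
  - eapply Ht, rt_refl.
  - eauto using interp_red1.
Qed.

Lemma interp_Inl (A B : proposition Atom) (t : proof_term) :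
  interp M A t -> interp M (Or A B) (Inl t).
Proof.
  intros Ht; split; [eauto using sn_Inl, interp_sn|split]; intros t1 H;
    destruct (red_Inl_inv H) as (t' & E & Ht'); [|discriminate].
  injection E as <-.
  now apply (candidate_red (interp_candidate A)) with t.
Qed.

Lemma interp_Inr (A B : proposition Atom) (t : proof_term) :
  interp M B t -> interp M (Or A B) (Inr t).
Proof.
  intros Ht; split; [eauto using sn_Inr, interp_sn|split]; intros t1 H;
    destruct (red_Inr_inv H) as (t' & E & Ht'); [discriminate|].
  injection E as <-.
  now apply (candidate_red (interp_candidate B)) with t.
Qed.

(** Preserves the hypothesis on a branch of [Case] when that branch reduces. *)
Lemma interp_subst1_red1 (A B : proposition Atom) (t t' : proof_term) :
  (forall u, interp M A u -> interp M B (subst1 u t)) -> red1 t t' ->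
  forall u, interp M A u -> interp M B (subst1 u t').
Proof.
  intros H Hr u Hu; apply interp_red1 with (subst1 u t); [auto|].
  now apply red1_subst.
Qed.

Lemma interp_Case (A B C : proposition Atom) (t u v : proof_term) :
  interp M (Or A B) t ->
  (forall a, interp M A a -> interp M C (subst1 a u)) ->
  (forall b, interp M B b -> interp M C (subst1 b v)) ->
  interp M C (Case t u v).
Proof.
  intros Ht; pose proof (interp_sn _ Ht) as Hsn; revert Ht u v.
  pattern t; revert t Hsn; apply sn_ind; intros t _ IHt Ht u v Hu.
  (* The induction on a branch needs its strong normalizability, which comes from its instances. *)
  pose proof (sn_of_instances _ _ Hu) as Hsn; revert Hu v.
  pattern u; revert u Hsn; apply sn_ind; intros u _ IHu Hu v Hv.
  pose proof (sn_of_instances _ _ Hv) as Hsn; revert Hv.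
  pattern v; revert v Hsn; apply sn_ind; intros v _ IHv Hv.
  apply (candidate_neutral (interp_candidate C)); [exact I|].
  intros t' H; inversion H; subst.
  - eapply Hu, Ht, rt_refl.
  - eapply Hv, Ht, rt_refl.
  - eauto using interp_red1.
  - apply IHu; [assumption|eapply interp_subst1_red1; eassumption|assumption].
  - apply IHv; [assumption|eapply interp_subst1_red1; eassumption].
Qed.

(** No rule contracts [Absurd] at its root, so its reducts are again of this form. *)
Lemma interp_Absurd (A : proposition Atom) (t : proof_term) :
  strongly_normalizable t -> interp M A (Absurd t).
Proof.
  intros Ht; pattern t; revert t Ht; apply sn_ind; intros t _ IHt.
  apply (candidate_neutral (interp_candidate A)); [exact I|].
  intros t' H; inversion H; subst; auto.
Qed.

(** * Monotonicity along polarized rewriting *)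

Variables (R : rewrite_system Atom) (HM : pre_model_of R M).

(** Both polarities are treated in one induction: [opp] on the left of an implication matches the
    contravariance of its interpretation there. *)
Lemma interp_rew1 (s : polarity) (A B : proposition Atom) :
  rew1 R s A B ->
  match s with
  | Neg => forall t, interp M A t -> interp M B t
  | Pos => forall t, interp M B t -> interp M A t
  end.
Proof.
  destruct HM as [Hneg Hpos].
  intros H; induction H as [s P A H|s A A' B _ IH|s A B B' _ IH|s A A' B _ IH
    |s A B B' _ IH|s A A' B _ IH|s A B B' _ IH]; destruct s; simpl in *;
    firstorder.
Qed.

Lemma interp_rew_Neg (A B : proposition Atom) :
  rew R Neg A B -> forall t, interp M A t -> interp M B t.
Proof.
  intros H; induction H as [A B H| |]; [exact (interp_rew1 H)|auto|auto].
Qed.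

Lemma interp_rew_Pos (A B : proposition Atom) :
  rew R Pos A B -> forall t, interp M B t -> interp M A t.
Proof.
  intros H; induction H as [A B H| |]; [exact (interp_rew1 H)|auto|auto].
Qed.

(** * Adequacy of typing derivations *)

Definition interp_context (Gamma : context Atom) (s : nat -> proof_term) : Prop :=
  forall n B, declares Gamma n B -> interp M B (s n).

Lemma interp_context_cons (Gamma : context Atom) (A : proposition Atom)
  (s : nat -> proof_term) (u : proof_term) :
  interp M A u -> interp_context Gamma s ->
  interp_context (A :: Gamma) (scons u s).
Proof.
  intros Hu Hs [|n] B; [|apply Hs].
  unfold declares; simpl; now intros [= <-].
Qed.

Lemma interp_subst (Gamma : context Atom) (t : proof_term)
  (A : proposition Atom) :
  proof_of R Gamma t A ->
  forall s, interp_context Gamma s -> interp M A (subst s t).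
Proof.
  intros H; induction H as
    [Gamma n A B C HB HBC HAC
    |Gamma t A B C _ IHt HC
    |Gamma t u A B C _ IHt HC _ IHu
    |Gamma t u A B C _ IHt _ IHu HC
    |Gamma t A B C _ IHt HC
    |Gamma t A B C _ IHt HC
    |Gamma t A B C _ IHt HC
    |Gamma t A B C _ IHt HC
    |Gamma t u v A B C D _ IHt HD _ IHu _ IHv
    |Gamma t A B _ IHt HB]; intros s Hs; simpl.
  (* Membership moves forward from [B] to [C] along negative steps, then backward from [C] to [A]
     along positive ones. *)
  - apply (interp_rew_Pos HAC), (interp_rew_Neg HBC), Hs, HB.
  - apply (interp_rew_Pos HC), interp_Lam; intros u Hu.
    rewrite subst1_up; auto using interp_context_cons.
  - apply interp_App with A; [apply (interp_rew_Neg HC)|]; auto.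
  - apply (interp_rew_Pos HC), interp_Pair; auto.
  - apply interp_Fst with B, (interp_rew_Neg HC); auto.
  - apply interp_Snd with A, (interp_rew_Neg HC); auto.
  - apply (interp_rew_Pos HC), interp_Inl; auto.
  - apply (interp_rew_Pos HC), interp_Inr; auto.
  - apply interp_Case with A B; [apply (interp_rew_Neg HD); auto| |];
      intros a Ha; rewrite subst1_up; auto using interp_context_cons.
  - apply interp_Absurd, (interp_rew_Neg HB); auto.
Qed.

End Interpretation.

Theorem theorem1 (Atom : Type) (R : rewrite_system Atom)
  (Hcomm : commuting R)
  (M : pre_model Atom) (HM : pre_model_of R M)
  (Gamma : context Atom) (A : proposition Atom) (pi : proof_term)
  (Hpi : proof_of R Gamma pi A)
  (sigma : partial_subst)
  (Hdom : forall n u, sigma n = Some u -> exists B, declares Gamma n B)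
  (Hsigma : forall n B u,
    declares Gamma n B -> sigma n = Some u -> interp M B u) :
  interp M A (apply_subst sigma pi).
Proof.
  apply (interp_subst HM Hpi); intros n B HB.
  (* Where [sigma] is undefined the variable stands for itself, and it lies in the candidate
     interpreting [B]. *)
  destruct (sigma n) as [u|] eqn:E; [eauto|].
  apply candidate_Var, interp_candidate.
Qed.
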